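(* Let $F$ and $H$ be graphs with $\chi(F)>\chi(H)$ and assume that $F$ has a color-critical edge. If $H$ is weakly $F$-Turán-stable, then $H$ is weakly $F$-Turán-good. Moreover, the same conclusion ($H$ is weakly $F$-Turán-good) is also implied by the following weaker assumption: for every $n$ there is an $n$-vertex $F$-free graph $G$ with $\mathcal{N}(H,G)=\mathrm{ex}(n,H,F)$ that can be obtained from a complete $(\chi(F)-1)$-partite graph by adding and removing $o(n^2)$ edges (where $o(n^2)$ is as $n\to\infty$).
   Context: All graphs are finite and simple. $\mathcal{N}(H,G)$ is the number of (not necessarily induced) subgraphs of $G$ isomorphic to $H$ (copies of $H$). A graph is $F$-free if it contains no copy of $F$ as a (not necessarily induced) subgraph. $\mathrm{ex}(n,H,F)$ is the maximum of $\mathcal{N}(H,G)$ over all $n$-vertex $F$-free graphs $G$. An edge of a graph is color-critical if deleting it decreases the chromatic number. $H$ is weakly $F$-Turán-good if for all sufficiently large $n$, $\mathrm{ex}(n,H,F)=\mathcal{N}(H,T)$ for some complete $(\chi(F)-1)$-partite $n$-vertex graph $T$ (depending on $n$). Let $\chi(H)<\chi(F)=k+1$. $H$ is weakly $F$-Turán-stable if: whenever $G$ is an $n$-vertex $F$-free graph with $\mathcal{N}(H,G)\ge \mathrm{ex}(n,H,F)-o(n^{|V(H)|})$, then $G$ can be obtained from a complete $k$-partite graph on the same vertex set by adding and removing $o(n^2)$ edges. That is, for every $\varepsilon>0$ there are $\delta>0$ and $n_0$ such that every $F$-free graph $G$ on $n\ge n_0$ vertices with $\mathcal{N}(H,G)\ge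 \mathrm{ex}(n,H,F)-\delta n^{|V(H)|}$ can be obtained from some complete $k$-partite graph on $V(G)$ by adding and removing at most $\varepsilon n^2$ edges. *)

(* Defs.v *)
From HB Require Import structures.
From mathcomp Require Import all_boot all_order all_algebra reals.

Set Implicit Arguments.
Unset Strict Implicit.
Unset Printing Implicit Defensive.

Import Order.TTheory GRing.Theory Num.Theory.

(* A finite simple graph on V is its set of edges, an edge being a
   two-element set of vertices; [graph V] is then itself a finType. *)
Record graph (V : finType) := Graph {
  edges : {set {set V}};
  edges2 : [forall e in edges, #|e| == 2]
}.

HB.instance Definition _ (V : finType) := [isSub for @edges V].
HB.instance Definition _ (V : finType) := [Finite of graph V by <:].

Definition adj (V : finType) (G : graph V) (u v : V) : bool :=
  [set u; v] \in edges G.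

Lemma del_edge_subproof (V : finType) (G : graph V) (e : {set V}) :
  [forall e' in edges G :\ e, #|e'| == 2].
Proof.
apply/forall_inP => e' /setD1P[_]; exact: (forall_inP (edges2 G)).
Qed.

Definition del_edge (V : finType) (G : graph V) (e : {set V}) : graph V :=
  Graph (del_edge_subproof G e).

Definition colorable (V : finType) (k : nat) (G : graph V) : bool :=
  [exists c : {ffun V -> 'I_k},
    [forall u, [forall v, adj G u v ==> (c u != c v)]]].

Lemma colorable_exists (V : finType) (G : graph V) :
  exists k, colorable k G.
Proof.
exists #|V|; apply/existsP; exists [ffun v => enum_rank v].
apply/forallP => u; apply/forallP => v; apply/implyP => uv.
rewrite !ffunE (inj_eq enum_rank_inj); apply/eqP => eq_uv.
by have /eqP := forall_inP (edges2 G) _ uv; rewrite eq_uv setUid cards1.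
Qed.

Definition chi (V : finType) (G : graph V) : nat :=
  ex_minn (colorable_exists G).

Definition color_critical (V : finType) (G : graph V) (e : {set V}) : bool :=
  (e \in edges G) && (chi (del_edge G e) < chi G).

(* The k parts are the colour classes of c. They may be empty, so that such
   graphs exist on any number n of vertices, including n < k. *)
Definition complete_multipartite (V : finType) (k : nat) (G : graph V) : bool :=
  [exists c : {ffun V -> 'I_k},
    [forall u, [forall v, adj G u v == (c u != c v)]]].

(* Subgraphs are pairs (vertex set, edge set), so that isolated vertices
   of a subgraph are taken into account. *)
Definition is_subgraph (V : finType) (S : {set V} * {set {set V}})
    (G : graph V) : bool :=
  (S.2 \subset edges G) && [forall e in S.2, e \subset S.1].

Definition isomorphic_to (U V : finType) (H : graph U)
    (S : {set V} * {set {set V}}) : bool :=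
  [exists f : {ffun U -> V},
    [&& injectiveb f,
        f @: [set: U] == S.1 &
        [set f @: e | e : {set U} in edges H] == S.2]].

Definition copies (U V : finType) (H : graph U) (G : graph V) :
    {set {set V} * {set {set V}}} :=
  [set S | is_subgraph S G & isomorphic_to H S].

Definition ncopies (U V : finType) (H : graph U) (G : graph V) : nat :=
  #|copies H G|.

Definition is_free (W V : finType) (F : graph W) (G : graph V) : bool :=
  copies F G == set0.

Definition gen_turan (n : nat) (U W : finType) (H : graph U) (F : graph W) : nat :=
  \max_(G : graph 'I_n | is_free F G) ncopies H G.

(* The number of edges to add or remove to turn G into G'. *)
Definition edit_dist (V : finType) (G G' : graph V) : nat :=
  #|(edges G :\: edges G') :|: (edges G' :\: edges G)|.

Definition weakly_Turan_good (U W : finType) (H : graph U) (F : graph W) :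
    Prop :=
  exists n0 : nat, forall n : nat, n0 <= n ->
    exists2 T : graph 'I_n,
      complete_multipartite (chi F).-1 T & gen_turan n H F = ncopies H T.

Local Open Scope ring_scope.

Definition weakly_Turan_stable (R : realType) (U W : finType)
    (H : graph U) (F : graph W) : Prop :=
  forall eps : R, 0 < eps ->
  exists2 delta : R, 0 < delta &
  exists n0 : nat, forall (n : nat) (G : graph 'I_n), (n0 <= n)%N ->
    is_free F G ->
    (gen_turan n H F)%:R - delta * n%:R ^+ #|U| <= (ncopies H G)%:R ->
    exists2 T : graph 'I_n,
      complete_multipartite (chi F).-1 T &
      (edit_dist T G)%:R <= eps * n%:R ^+ 2.

Definition near_multipartite_extremal (R : realType) (U W : finType)
    (H : graph U) (F : graph W) : Prop :=
  exists G T : forall n : nat, graph 'I_n,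
    [/\ forall n, is_free F (G n),
        forall n, ncopies H (G n) = gen_turan n H F,
        forall n, complete_multipartite (chi F).-1 (T n) &
        forall eps : R, 0 < eps -> exists n0 : nat, forall n : nat,
          (n0 <= n)%N -> (edit_dist (T n) (G n))%:R <= eps * n%:R ^+ 2].

(* Main.v *)
Require Import Defs.
From mathcomp Require Import all_boot all_order all_algebra reals.
From mathcomp Require Import perm zify.

Set Implicit Arguments.
Unset Strict Implicit.
Unset Printing Implicit Defensive.

Import Order.TTheory GRing.Theory Num.Theory.

(* Copies of H are counted through injective homomorphisms, a multiple of them
   by the constant |Aut H|. Let k = chi F - 1 and let G be extremal and close to
   a complete k-partite graph T. If H has an edge, all classes of T have linear
   size: merging a tiny class into another one and splitting a large class
   instead would create a positive proportion of new copies. Move every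
   atypical vertex to a class in which it has few neighbours; there is one,
   since a vertex with many neighbours in all classes, or an edge inside a class
   between vertices adjacent to almost all other classes, would play the role of
   (an end of) the critical edge of a copy of F. Now inner edges only occur at
   vertices missing linearly many cross edges, and each of these vertices has
   far fewer inner edges than missing ones; as every cross edge lies in
   Omega(n^(|U|-2)) copies of H, replacing G by the complete k-partite graph on
   the new partition does not lose copies. *)

(** * Graphs and embeddings *)

Lemma adjC (V : finType) (G : graph V) u v : adj G u v = adj G v u.
Proof. by rewrite /adj setUC. Qed.

Lemma adj_irr (V : finType) (G : graph V) u : adj G u u = false.
Proof.
apply/negP => uu.
by have := forall_inP (edges2 G) _ uu; rewrite setUid cards1.
Qed.

Lemma adj_neq (V : finType) (G : graph V) u v : adj G u v -> u != v.
Proof. by apply: contraTneq => ->; rewrite adj_irr. Qed.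

Lemma edgeP (V : finType) (G : graph V) (e : {set V}) :
  e \in edges G -> exists u v, e = [set u; v] /\ adj G u v.
Proof.
move=> eG; have /cards2P[u [v [_ euv]]] := forall_inP (edges2 G) _ eG.
by exists u, v; rewrite /adj -euv.
Qed.

Section CompleteMultipartite.

Variables (V : finType) (k : nat) (c : V -> 'I_k).

Fact multipartite_subproof :
  [forall e in [set [set p.1; p.2] | p in [set p : V * V | c p.1 != c p.2]],
    #|e| == 2].
Proof.
apply/forall_inP => e /imsetP[p]; rewrite inE => cp ->.
by rewrite cards2 (contra_neq (@congr1 _ _ c _ _) cp).
Qed.

(** The colouring stays an explicit parameter because the arguments below keep modifying the
    partition, while [complete_multipartite] only asserts that one exists. *)
Definition multipartite : graph V := Graph multipartite_subproof.

Lemma adj_multipartite u v : adj multipartite u v = (c u != c v).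
Proof.
apply/imsetP/idP => [[[a b]]|cuv]; last by exists (u, v); rewrite ?inE.
rewrite inE /= => cab /setP euv.
have uab := euv u; have vab := euv v; have := euv a; have := euv b.
rewrite !inE !eqxx ?orbT /= in uab vab *.
case/esym/orP: uab cab => /eqP -> cab; case/esym/orP: vab => /eqP ->; rewrite ?orbb //.
- by move=> /eqP ba; rewrite ba eqxx in cab.
- by move=> _ _; rewrite eq_sym.
- by move=> _ /eqP ab; rewrite ab eqxx in cab.
Qed.

Lemma multipartiteP : complete_multipartite k multipartite.
Proof.
apply/existsP; exists [ffun v => c v].
by apply/forallP => u; apply/forallP => v; rewrite adj_multipartite !ffunE.
Qed.

End CompleteMultipartite.

Section Embeddings.

Variables (U V : finType) (H : graph U).

Definition embs (G : graph V) : {set {ffun U -> V}} :=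
  [set f : {ffun U -> V} | injectiveb f & [forall p, [forall q, adj H p q ==> adj G (f p) (f q)]]].

Lemma embsP (G : graph V) (f : {ffun U -> V}) :
  reflect (injective f /\ forall p q, adj H p q -> adj G (f p) (f q))
          (f \in embs G).
Proof.
rewrite inE; apply: (iffP andP) => -[/injectiveP f_inj fH]; split=> //.
  by move=> p q; have /forallP/(_ q)/implyP := forallP fH p.
by apply/forallP => p; apply/forallP => q; apply/implyP/fH.
Qed.

Definition im_copy (f : {ffun U -> V}) : {set V} * {set {set V}} :=
  (f @: setT, [set f @: e | e : {set U} in edges H]).

Lemma mem_copies (G : graph V) S :
  S \in copies H G -> exists2 f, f \in embs G & im_copy f = S.
Proof.
rewrite inE => /andP[/andP[subG _] /existsP[f /and3P[/injectiveP f_inj]]].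
move=> /eqP im1 /eqP im2; exists f; last by rewrite /im_copy im1 im2; case: S {subG im1 im2}.
apply/embsP; split=> // p q pq; apply: (subsetP subG).
by rewrite -im2; apply/imsetP; exists [set p; q]; rewrite // imsetU1 imset_set1.
Qed.

Lemma im_copy_in (G : graph V) f : f \in embs G -> im_copy f \in copies H G.
Proof.
move=> /embsP[f_inj fH]; rewrite inE; apply/andP; split; last first.
  by apply/existsP; exists f; rewrite !eqxx !andbT; apply/injectiveP.
apply/andP; split.
  apply/subsetP => e /imsetP[e' /edgeP[p [q [-> pq]]] ->].
  by rewrite imsetU1 imset_set1; apply: fH.
apply/forall_inP => e /imsetP[e' _ ->]; exact/imsetS/subsetT.
Qed.

End Embeddings.

Lemma is_freeP (U V : finType) (H : graph U) (G : graph V) :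
  reflect (forall f, f \notin embs H G) (is_free H G).
Proof.
apply: (iffP eqP) => [c0 f|noemb].
  by apply/negP => /im_copy_in; rewrite c0 inE.
by apply/setP => S; rewrite in_set0; apply/negP => /mem_copies[f]; rewrite (negPf (noemb f)).
Qed.

(* An injective endomorphism of a finite graph is an automorphism, so
   [embs H H] is the automorphism group of H. *)
Lemma card_embs (U V : finType) (H : graph U) (G : graph V) :
  #|embs H G| = #|embs H H| * ncopies H G.
Proof.
rewrite -sum1_card (partition_big (im_copy H) (mem (copies H G))) /=; last first.
  by move=> f; apply: im_copy_in.
rewrite mulnC /ncopies -sum_nat_const; apply: eq_bigr => S /mem_copies[f0 f0G <-].
rewrite sum1_card; have /embsP[f0_inj _] := f0G.
(* The embeddings with the same image as [f0] are exactly the composites of [f0] with an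
   automorphism [s]. *)
pose cf (s : {ffun U -> U}) : {ffun U -> V} := [ffun u => f0 (s u)].
have cf_inj : injective cf.
  by move=> s t /ffunP st; apply/ffunP => u; have := st u; rewrite !ffunE => /f0_inj.
rewrite -(card_imset _ cf_inj); apply: eq_card => f.
rewrite [LHS]inE; apply/andP/imsetP => [[fG /eqP[im1 im2]]|[s /embsP[s_inj sH] ->]].
  have /embsP[f_inj _] := fG.
  have ex_s u : exists v, f0 v == f u.
    have : f u \in f0 @: setT by rewrite -im1 imset_f.
    by case/imsetP => v _ ->; exists v.
  pose s := [ffun u => xchoose (ex_s u)].
  have f0s u : f0 (s u) = f u by rewrite ffunE; apply/eqP/(xchooseP (ex_s u)).
  exists s; last by apply/ffunP => u; rewrite ffunE f0s.
  apply/embsP; split=> [u v /(congr1 f0)|p q pq]; first by rewrite !f0s => /f_inj.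
  have : f @: [set p; q] \in [set f0 @: e | e : {set U} in edges H].
    by rewrite -im2; apply: imset_f.
  case/imsetP => e eH; rewrite imsetU1 imset_set1 -!f0s => eq_e.
  have eqe : [set s p; s q] = e by apply: (imset_inj f0_inj); rewrite imsetU1 imset_set1.
  by rewrite /adj eqe.
have cs_inj : injective (cf s) by move=> u v; rewrite !ffunE => /f0_inj/s_inj.
have sS (e : {set U}) : cf s @: e = f0 @: (s @: e).
  by rewrite -imset_comp; apply: eq_imset => u; rewrite ffunE.
(* The vertex and edge images of [cf s] lie in those of [f0], and injectivity makes the
   cardinalities agree. *)
have eq_im : im_copy H (cf s) = im_copy H f0.
  congr pair; apply/eqP; rewrite eqEcard.
    by rewrite !card_imset // leqnn andbT sS imsetS // subsetT.
  rewrite !card_imset ?leqnn ?andbT; try exact: imset_inj.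
  apply/subsetP => _ /imsetP[_ /edgeP[p [q [-> pq]]] ->].
  by rewrite sS imset_f // imsetU1 imset_set1; apply: sH.
split; last by rewrite eq_im.
apply/embsP; split=> // p q pq; have /embsP[_ f0H] := f0G.
by rewrite !ffunE; apply/f0H/sH.
Qed.

Lemma embs_refl_gt0 (U : finType) (H : graph U) : 0 < #|embs H H|.
Proof.
apply/card_gt0P; exists [ffun u => u]; apply/embsP.
by split=> [u v|p q]; rewrite !ffunE.
Qed.

(** The factor [#|embs H H|] is positive and the same for both graphs, so it cancels. *)
Lemma leq_ncopies (U V : finType) (H : graph U) (G G' : graph V) :
  (ncopies H G <= ncopies H G') = (#|embs H G| <= #|embs H G'|).
Proof. by rewrite (card_embs H G) (card_embs H G') leq_pmul2l ?embs_refl_gt0. Qed.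

(** Ordered pairs, so that the count is a sum of degrees over the first vertex; each edited edge
    appears twice. *)
Definition wrong (V : finType) (G G' : graph V) : {set V * V} :=
  [set p | adj G p.1 p.2 != adj G' p.1 p.2].

Definition lost (V : finType) (G G' : graph V) : {set V * V} :=
  [set p | adj G p.1 p.2 && ~~ adj G' p.1 p.2].

Lemma leq_card_bigcup (I T : finType) (J : {set I}) (F : I -> {set T}) :
  #|\bigcup_(i in J) F i| <= \sum_(i in J) #|F i|.
Proof.
elim/big_ind2: _ => [|A m B m' Am Bm'|//]; first by rewrite cards0.
by rewrite (leq_trans (leq_card_setU _ _)) // leq_add.
Qed.

(** A wrong pair lies in the square of an edited edge, which has four elements; the diagonal is not
    worth excluding. *)
Lemma card_wrong (V : finType) (G G' : graph V) :
  #|wrong G G'| <= 4 * edit_dist G G'.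
Proof.
rewrite /edit_dist; set D := _ :|: _.
have sub : wrong G G' \subset \bigcup_(e in D) setX e e.
  apply/subsetP => -[x y]; rewrite inE /= => xy.
  apply/bigcupP; exists [set x; y]; last by rewrite !inE !eqxx orbT.
  by move: xy; rewrite /adj !inE; do 2![case: (_ \in _)].
apply: leq_trans (subset_leq_card sub) _.
apply: leq_trans (leq_card_bigcup _ _) _.
rewrite mulnC -sum_nat_const; apply: leq_sum => e eD.
suff /eqP e2 : #|e| == 2 by rewrite cardsX e2.
have : e \in edges G \/ e \in edges G' by move: eD; rewrite !inE; do 2![case: (_ \in _)]; auto.
by case=> eG; [exact: (forall_inP (edges2 G)) | exact: (forall_inP (edges2 G'))].
Qed.

(** * Counting embeddings *)

(** Elements of [A] are dealt out cyclically, by their index modulo [#|J|]; a label of rank [r] then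
    occurs at the indices [i * #|J| + r] with [i < m]. *)
Lemma equisplit (V J : finType) (A : {set V}) (m : nat) :
  0 < #|J| -> m * #|J| <= #|A| ->
  exists g : V -> J, forall j, m <= #|[set v in A | g v == j]|.
Proof.
move=> J0 mA.
have lt_mod v : index v (enum A) %% #|J| < #|J| by rewrite ltn_mod.
exists (fun v => enum_val (Ordinal (lt_mod v))) => j.
have [->//|m0] := posnP m.
have lt_ix (i : 'I_m) : i * #|J| + enum_rank j < #|A|.
  apply: leq_trans mA; apply: (@leq_trans (i.+1 * #|J|)).
    by rewrite mulSn addnC ltn_add2r ltn_ord.
  by rewrite leq_mul2r ltn_ord orbT.
pose F (i : 'I_m) := enum_val (Ordinal (lt_ix i)).
have indexF i : index (F i) (enum A) = i * #|J| + enum_rank j.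
  by rewrite /F /enum_val /= index_uniq ?enum_uniq // -cardE lt_ix.
have F_inj : injective F.
  move=> i i' /(congr1 (index^~ (enum A))); rewrite !indexF => /addIn.
  by move/eqP; rewrite eqn_pmul2r // => /eqP/val_inj.
apply: (@leq_trans #|F @: setT|); first by rewrite card_imset // cardsT card_ord.
apply/subset_leq_card/subsetP => _ /imsetP[i _ ->].
rewrite inE enum_valP /=; apply/eqP; rewrite -[RHS]enum_rankK; congr enum_val.
by apply: val_inj; rewrite /= indexF modnMDl modn_small.
Qed.

Lemma card_family_prod (U V : finType) (S : U -> {set V}) :
  #|family S| = \prod_u #|S u|.
Proof. by rewrite card_family foldrE big_image. Qed.

(** In the applications [P] holds the vertices of H whose image is prescribed, and the others have
    at least [m] choices each. *)
Lemma leq_exp_family (U V : finType) (S : U -> {set V}) (P : {set U}) m :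
  (forall u, u \in P -> 0 < #|S u|) -> (forall u, u \notin P -> m <= #|S u|) ->
  m ^ (#|U| - #|P|) <= #|family S|.
Proof.
move=> S0 Sm; rewrite -[P]setCK -cardsCs card_family_prod -prod_nat_const big_mkcond /=.
apply: leq_prod => u _; rewrite inE; case: ifP => [/Sm //|].
by move/negbFE/S0.
Qed.

Lemma family_leq_exp (U V : finType) (S : U -> {set V}) (P : {set U}) :
  (forall u, u \in P -> #|S u| <= 1) -> #|family S| <= #|V| ^ (#|U| - #|P|).
Proof.
move=> S1; rewrite -[P]setCK -cardsCs card_family_prod -prod_nat_const [leqRHS]big_mkcond /=.
apply: leq_prod => u _; rewrite inE; case: ifP => [_|]; first exact: max_card.
by move/negbFE/S1.
Qed.

Section Counting.

Variables (U V : finType) (H : graph U).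
Local Notation h := #|U|.
Local Notation n := #|V|.

(** An embedding that fails in [G'] sends some edge of H to a lost pair: choose the ordered edge,
    the pair, and then the images of the other vertices. *)
Lemma card_embs_lost (G G' : graph V) :
  #|embs H G :\: embs H G'| <= h ^ 2 * #|lost G G'| * n ^ (h - 2).
Proof.
pose X (t : (U * U) * (V * V)) : {set {ffun U -> V}} :=
  [set f : {ffun U -> V} | [&& t.1.1 != t.1.2, f t.1.1 == t.2.1 & f t.1.2 == t.2.2]].
have sub : embs H G :\: embs H G' \subset \bigcup_(t in setX [set: U * U] (lost G G')) X t.
  apply/subsetP => f /setDP[/embsP[f_inj fG]]; rewrite inE.
  move/injectiveP: (f_inj) => -> /forallPn[p /forallPn[q]].
  rewrite negb_imply => /andP[pq nG'].
  apply/bigcupP; exists ((p, q), (f p, f q)); first by rewrite !inE /= fG.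
  by rewrite inE /= !eqxx (adj_neq pq).
apply: leq_trans (subset_leq_card sub) _; apply: leq_trans (leq_card_bigcup _ _) _.
have -> : h ^ 2 * #|lost G G'| = #|setX [set: U * U] (lost G G')|.
  by rewrite cardsX cardsT card_prod mulnn.
rewrite -sum_nat_const; apply: leq_sum => -[[p q] [x y]] _.
have [<-|pq] := eqVneq p q.
  by rewrite (_ : X _ = set0) ?cards0 //; apply/setP => f; rewrite !inE eqxx.
pose S u := if u == p then [set x] else if u == q then [set y] else setT.
have -> : 2 = #|[set p; q]| by rewrite cards2 pq.
apply: leq_trans (family_leq_exp (S := S) (P := [set p; q]) _); last first.
  by move=> u; rewrite !inE /S; case: eqP => [|_ /= ->]; rewrite cards1.
apply/subset_leq_card/subsetP => f; rewrite inE /= => /and3P[_ /eqP fp /eqP fq].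
apply/familyP => u; rewrite /S; case: eqP => [->|_]; first by rewrite fp inE.
by case: eqP => [->|_]; rewrite inE // fq.
Qed.

Variables (k : nat) (c : V -> 'I_k) (col : U -> 'I_k).
Hypothesis col_proper : forall p q, adj H p q -> col p != col q.
Local Notation T := (multipartite c).

(** Pieces inside the right classes give adjacency, and disjointness of the pieces gives
    injectivity. *)
Lemma family_embs (S : U -> {set V}) (f : {ffun U -> V}) :
  (forall u v, v \in S u -> c v = col u) ->
  (forall u u' v, v \in S u -> v \in S u' -> u = u') ->
  f \in family S -> f \in embs H T.
Proof.
move=> Sc Sd /familyP fS; apply/embsP; split=> [u u' fu|p q pq].
  by apply: (Sd _ _ (f u)) => //; rewrite fu.
by rewrite adj_multipartite !(Sc _ _ (fS _)) col_proper.
Qed.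

(* One piece of each class for every vertex of H: maps sending each vertex to a
   piece of its own are automatically injective. *)
Lemma class_split m (P : pred 'I_k) :
    (forall i, P i -> m * h <= #|[set v | c v == i]|) -> 0 < h ->
  exists g : V -> U, forall i u, P i -> m <= #|[set v | (c v == i) && (g v == u)]|.
Proof.
move=> le_m h0.
have ex_g i : exists g : V -> U, P i -> forall u, m <= #|[set v | (c v == i) && (g v == u)]|.
  have [Pi|_] := boolP (P i); last first.
    by have /card_gt0P[u _] := h0; exists (fun=> u).
  have [g gP] := equisplit h0 (le_m _ Pi); exists g => _ u.
  by apply: leq_trans (gP u) _; apply: subset_leq_card; apply/subsetP => v; rewrite !inE.
have [g gP] := fin_all_exists ex_g.
exists (fun v => g (c v) v) => i u Pi; apply: leq_trans (gP i Pi u) _.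
by apply: subset_leq_card; apply/subsetP => v; rewrite !inE => /andP[/eqP -> ->]; rewrite eqxx.
Qed.

(** One vertex is chosen freely from each piece. Only embeddings realising [col] are counted, since
    [split_class_gain] recognises new embeddings by their colours. *)
Lemma leq_card_embs m :
  (forall u, m * h <= #|[set v | c v == col u]|) ->
  m ^ h <= #|[set f in embs H T | [forall u, c (f u) == col u]]|.
Proof.
move=> le_m; have [h0|h0] := posnP h.
  rewrite {1}h0 expn0.
  have void (u : U) : False by have := card0_eq h0 u.
  apply/card_gt0P; exists [ffun u => match void u with end]; rewrite !inE -andbA.
  apply/and3P; split; first by apply/injectiveP => u; case: (void u).
    by apply/forallP => u; case: (void u).
  by apply/forallP => u; case: (void u).
have [i|g gP] := class_split (P := [pred i | [exists u, col u == i]]) (m := m) _ h0.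
  by move=> /existsP[u /eqP <-].
pose S u := [set v | (c v == col u) && (g v == u)].
have := leq_exp_family (S := S) (P := set0) (m := m); rewrite cards0 subn0 => lb.
apply: leq_trans (lb _ _) _ => [u|u _|].
- by rewrite inE.
- by apply: gP; apply/existsP; exists u.
apply/subset_leq_card/subsetP => f fS; rewrite inE.
rewrite (family_embs _ _ fS) /=.
- by apply/forallP => u; have /familyP/(_ u) := fS; rewrite inE => /andP[].
- by move=> u v; rewrite inE => /andP[/eqP].
by move=> u u' v; rewrite !inE => /andP[_ /eqP <-] /andP[_ /eqP].
Qed.

End Counting.

(** One transposition sends [a] to [a']; a second one corrects the image of [b] and fixes [a']. It
    serves to align the colours of an edge of H with those of a given cross pair. *)
Lemma perm_two (k : nat) (a b a' b' : 'I_k) : a != b -> a' != b' ->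
  exists s : 'I_k -> 'I_k, [/\ injective s, s a = a' & s b = b'].
Proof.
move=> ab ab'; exists (fun i => tperm (tperm a a' b) b' (tperm a a' i)); split.
- by move=> i j /perm_inj/perm_inj.
- rewrite tpermL tpermD // 1?eq_sym // -[a' in a' != _](tpermL a a').
  by rewrite (inj_eq perm_inj).
- by rewrite tpermL.
Qed.

Section Exchange.

Variables (U V : finType) (H : graph U).
Local Notation h := #|U|.
Local Notation n := #|V|.
Variables (k : nat) (c : V -> 'I_k) (col : U -> 'I_k).
Hypothesis col_proper : forall p q, adj H p q -> col p != col q.
Local Notation T := (multipartite c).

(** After renaming colours so that [p] and [q] fit the classes of [x] and [y], these two are pinned
    and the other vertices of H roam over their own pieces. *)
Lemma leq_card_embs_at (p q : U) (x y : V) m :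
    adj H p q -> c x != c y ->
    (forall i, m.+2 * h <= #|[set v | c v == i]|) ->
  m ^ (h - 2) <= #|[set f in embs H T | (f p == x) && (f q == y)]|.
Proof.
move=> pq cxy le_m; have p_q := adj_neq pq.
have h0 : 0 < h by apply/card_gt0P; exists p.
have [s [s_inj sp sq]] := perm_two (col_proper pq) cxy.
have [g gP] := class_split (P := predT) (fun i _ => le_m i) h0.
(* Removing [x] and [y] from the other pieces keeps the maps injective; this is what the surplus of
   2 in [m.+2] pays for. *)
pose S u := if u == p then [set x] else if u == q then [set y] else
  [set v | (c v == s (col u)) && (g v == u)] :\: [set x; y].
have Sp : S p = [set x] by rewrite /S eqxx.
have Sq : S q = [set y] by rewrite /S eqxx eq_sym (negPf p_q).
have -> : 2 = #|[set p; q]| by rewrite cards2 p_q.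
apply: leq_trans (leq_exp_family (S := S) (P := [set p; q]) _ _) _ => [u|u|].
- by rewrite !inE => /orP[]/eqP ->; rewrite ?Sp ?Sq cards1.
- rewrite !inE negb_or => /andP[/negPf up /negPf uq]; rewrite /S up uq cardsD.
  rewrite leq_subRL; last by apply: subset_leq_card; apply: subsetIl.
  apply: leq_trans (gP _ u isT); rewrite -(addn2 m) addnC leq_add2l.
  by apply: leq_trans (subset_leq_card (subsetIr _ _)) _; rewrite cards2; case: eqP.
apply/subset_leq_card/subsetP => f fS; have /familyP fSu := fS.
have := fSu p; have := fSu q; rewrite Sp Sq !inE => /eqP -> /eqP ->; rewrite !eqxx !andbT.
have xy : x != y by apply: contraNneq cxy => ->.
suff : f \in embs H T by rewrite inE.
apply: (family_embs (col := s \o col) _ _ _ fS) => [p' q' pq'|u v|u u' v] /=.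
- by rewrite (inj_eq s_inj) col_proper.
- rewrite /S; case: eqP => [->|_]; first by rewrite inE sp => /eqP ->.
  case: eqP => [->|_]; first by rewrite inE sq => /eqP ->.
  by rewrite !inE => /andP[_ /andP[/eqP]].
rewrite /S; case: (u =P p) => [->|_]; case: (u' =P p) => [->|_] //;
  (try case: (u =P q) => [->|_]); (try case: (u' =P q) => [->|_] //); rewrite !inE.
- by move=> /eqP -> /eqP E; rewrite E eqxx in xy.
- by move=> /eqP ->; rewrite eqxx.
- by move=> /eqP -> /eqP E; rewrite E eqxx in xy.
- by move=> /andP[/norP[xv _] _] /eqP E; rewrite E eqxx in xv.
- by move=> /eqP ->; rewrite eqxx orbT.
- by move=> /andP[/norP[_ xv] _] /eqP E; rewrite E eqxx in xv.
by move=> /and3P[_ _ /eqP <-] /and3P[_ _ /eqP <-].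
Qed.

(** Embeddings common to both graphs cancel. Those only in [G] are bounded by [card_embs_lost], and
    each cross pair missing in [G] yields new ones by [leq_card_embs_at]. *)
Lemma embs_exchange (p q : U) (G : graph V) m :
    adj H p q -> (forall i, m.+2 * h <= #|[set v | c v == i]|) ->
  #|embs H G| + #|lost T G| * m ^ (h - 2) <=
  #|embs H T| + h ^ 2 * #|lost G T| * n ^ (h - 2).
Proof.
move=> pq le_m; rewrite -(cardsID (embs H T) (embs H G)) -(cardsID (embs H G) (embs H T)).
rewrite setIC -!addnA leq_add2l addnC leq_add //; last exact: card_embs_lost.
(* The embeddings sending (p, q) to (x, y) are disjoint for distinct (x, y), so
   no embedding is counted twice in the gain. *)
pose X := [set f in embs H T | (f p, f q) \in lost T G].
apply: (@leq_trans #|X|); last first.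
  apply/subset_leq_card/subsetP => f /setIdP[fT]; rewrite in_set => /andP[_ /= nG].
  by rewrite in_setD fT andbT; apply: contraNN nG => /embsP[_]; apply.
rewrite -[leqRHS]sum1_card (partition_big (fun f : {ffun U -> V} => (f p, f q))
  (mem (lost T G))) /=; last first.
  by move=> f /setIdP[].
rewrite -sum_nat_const; apply: leq_sum => -[x y] xyL; rewrite sum1_card.
have cxy : c x != c y by move: xyL; rewrite inE adj_multipartite => /andP[].
apply: leq_trans (leq_card_embs_at pq cxy le_m) _.
apply/subset_leq_card/subsetP => f /setIdP[fT /andP[/eqP fp /eqP fq]].
by rewrite unfold_in /= fp fq eqxx andbT; apply/setIdP; split; rewrite // fp fq.
Qed.

End Exchange.

(** * Unbalanced partitions and embedding F *)

(** The classes of size at most [t] cover at most [k * t] vertices, so few maps hit them. With more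
    embeddings than that, one avoids all these classes, and it pulls [c] back to the colouring. *)
Lemma exists_large_coloring (U V : finType) (H : graph U) k (c : V -> 'I_k) t :
    #|U| * (k * t) * #|V| ^ (#|U| - 1) < #|embs H (multipartite c)| ->
  exists col : U -> 'I_k, (forall p q, adj H p q -> col p != col q) /\
    forall u, t < #|[set v | c v == col u]|.
Proof.
move=> many; have [/exists_inP[f /embsP[_ fH] /forallP f_large]|none] :=
    boolP [exists f in embs H (multipartite c),
             [forall u, t < #|[set v | c v == c (f u)]|]].
  exists (fun u => c (f u)); split=> // p q /fH; rewrite adj_multipartite //.
case/negP: none; apply: contraLR many => none; rewrite -leqNgt.
pose small := [set x | #|[set v | c v == c x]| <= t].
have card_small : #|small| <= k * t.
  rewrite -[k in k * _]card_ord -sum_nat_const.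
  apply: (@leq_trans (\sum_(i : 'I_k) if #|[set v | c v == i]| <= t
                                      then #|[set v | c v == i]| else 0)); last first.
    by apply: leq_sum => i _; case: ifP.
  rewrite -big_mkcond /= -sum1_card.
  rewrite (partition_big c (fun i => #|[set v | c v == i]| <= t)) /=; last first.
    by move=> x; rewrite inE.
  apply: leq_sum => i le_i; rewrite sum1_card; apply: subset_leq_card.
  by apply/subsetP => x; rewrite unfold_in !inE => /andP[].
pose X u := [set f : {ffun U -> V} | f u \in small].
apply: (@leq_trans (\sum_(u : U) #|X u|)).
  have -> : \sum_(u : U) #|X u| = \sum_(u in [set: U]) #|X u|.
    by apply: eq_bigl => u; rewrite inE.
  apply: leq_trans (leq_card_bigcup _ _); apply/subset_leq_card/subsetP => f fT.
  move: none; rewrite negb_exists => /forallP/(_ f).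
  rewrite fT /= => /forallPn[u]; rewrite -leqNgt => fu.
  by apply/bigcupP; exists u; rewrite !inE.
rewrite -mulnA -[X in _ <= X * _]cardsT -sum_nat_const big_mkcond /= [leqRHS]big_mkcond /=.
apply: leq_sum => u _; rewrite inE.
pose S u' := if u' == u then small else setT.
apply: (@leq_trans #|family S|).
  apply/subset_leq_card/subsetP => f; rewrite inE => fu; apply/familyP => u'.
  by rewrite /S; case: eqP => [->|_]; rewrite // inE.
rewrite card_family_prod (bigD1 u) //= {1}/S eqxx leq_mul //.
have <- : #|[set~ u]| = #|U| - 1 by rewrite cardsCs setCK cards1.
rewrite -prod_nat_const (eq_bigl (mem [set~ u])); last by move=> u'; rewrite !inE.
by apply: leq_prod => u' _; exact: max_card.
Qed.

(* Class s is merged into the class of q, and its colour is reused for half of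
   the class of p; edges inside the latter class carry the new embeddings. *)
Lemma split_class_gain (U V : finType) (H : graph U) k (c : V -> 'I_k)
    (col : U -> 'I_k) (p q : U) (s : 'I_k) m :
    (forall p q, adj H p q -> col p != col q) -> adj H p q ->
    (forall u, col u != s) ->
    (forall u, m * #|U| * 2 <= #|[set v | c v == col u]|) ->
  exists c' : V -> 'I_k,
    #|embs H (multipartite c)| + m ^ #|U| <= #|embs H (multipartite c')| +
      #|U| ^ 2 * (2 * (#|[set v | c v == s]| * #|V|)) * #|V| ^ (#|U| - 2).
Proof.
move=> colH pq col_s large; set T := multipartite c.
have [||g gP] := @equisplit V bool [set v | c v == col p] (m * #|U|).
- by rewrite card_bool.
- by rewrite card_bool.
set i := col p in gP; set j := col q; have ij : i != j := colH _ _ pq.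
pose c' v := if c v == s then j else if (c v == i) && g v then s else c v.
(* Vertices of colour [j] are redirected to the split-off half of class [i], which now carries
   colour [s]; those of colour [i] stay in the other half. *)
pose col' u := if col u == j then s else col u.
have col'H p' q' : adj H p' q' -> col' p' != col' q'.
  move/colH; rewrite /col'; case: (col p' =P j) => [->|_]; case: (col q' =P j) => [->|_] //.
    by rewrite eqxx.
  by rewrite [s == _]eq_sym col_s.
have c'i v : c' v = i -> c v = i.
  rewrite /c'; case: ifP => [_ /eqP|_]; first by rewrite eq_sym (negPf ij).
  by case: ifP => // _ /esym/eqP; rewrite (negPf (col_s p)).
have c's v : c' v = s -> c v = i.
  rewrite /c'; case: (c v =P s) => [_ /eqP|cv]; first by rewrite (negPf (col_s q)).
  by case: ifP => // /andP[/eqP].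
exists c'; set T' := multipartite c'.
(* Embeddings realising [col'] send [p] and [q] both into the old class [i], so none of them is an
   embedding into [T]. *)
have gain : m ^ #|U| <= #|embs H T' :\: embs H T|.
  apply: leq_trans (leq_card_embs (c := c') col'H _) _ => [u|].
    rewrite /col'; case: (col u =P j) => [_|/eqP uj].
      apply: leq_trans (gP true) _; apply/subset_leq_card/subsetP => v.
      rewrite !inE /c' => /andP[/eqP -> /eqP ->].
      by rewrite (negPf (col_s p)) !eqxx.
    have [ui|ui] := eqVneq (col u) i.
      apply: leq_trans (gP false) _; apply/subset_leq_card/subsetP => v.
      rewrite !inE /c' => /andP[/eqP -> /eqP ->].
      by rewrite (negPf (col_s p)) ui andbF.
    apply: leq_trans (leq_trans _ (large u)) _; first by rewrite leq_pmulr.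
    apply/subset_leq_card/subsetP => v; rewrite !inE /c' => /eqP ->.
    by rewrite (negPf (col_s u)) (negPf ui).
  apply/subset_leq_card/subsetP => f /setIdP[fT' /forallP fc].
  rewrite in_setD fT' andbT; apply/embsP => -[_ /(_ _ _ pq)].
  rewrite adj_multipartite; apply/negP; rewrite negbK.
  have := fc p; have := fc q; rewrite /col' !eqxx (negPf ij) => /eqP/c's -> /eqP/c'i ->.
  exact: eqxx.
(* Splitting destroys no adjacency, so a lost pair has an end in the old class [s]; the factor 2
   covers the choice of that end. *)
have loss : #|lost T T'| <= 2 * (#|[set v | c v == s]| * #|V|).
  pose A := [set v | c v == s].
  have sub : lost T T' \subset setX A setT :|: setX setT A.
    apply/subsetP => -[v w]; rewrite !inE /= !adj_multipartite negbK /c' andbT.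
    case: (c v =P s) => [//|/eqP vs]; case: (c w =P s) => [//|/eqP ws] /andP[vw].
    case: ifP => [/andP[/eqP cv _]|_]; case: ifP => [/andP[/eqP cw _]|_].
    - by rewrite cv cw eqxx in vw.
    - by rewrite eq_sym (negPf ws).
    - by rewrite (negPf vs).
    - by rewrite (negPf vw).
  apply: leq_trans (subset_leq_card sub) _; apply: leq_trans (leq_card_setU _ _) _.
  by rewrite !cardsX cardsT mulnC addnn mul2n [#|V| * _]mulnC.
rewrite -(cardsID (embs H T') (embs H T)) -(cardsID (embs H T) (embs H T')).
rewrite setIC -!addnA leq_add2l addnC leq_add //.
apply: leq_trans (card_embs_lost H T T') _.
by rewrite leq_mul2r leq_mul2l loss !orbT.
Qed.

Section Greedy.

Variables (V W : finType) (G : graph V) (k : nat) (c : V -> 'I_k).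
Variables (B : {set V}) (t : nat).
Hypothesis good : forall v, v \notin B ->
  #|[set z | (c z != c v) && ~~ adj G v z]| <= t.

(** Vertices are placed one at a time: each earlier image, lying outside [B], excludes only itself
    and at most [t] non-neighbours in other classes, so the piece is never exhausted. *)
Lemma greedy_embedding (col : W -> 'I_k) (S : 'I_k -> {set V}) :
    (forall i v, v \in S i -> c v = i /\ v \notin B) ->
    (forall i, #|W| * t.+1 < #|S i|) ->
  forall s : seq W, uniq s -> exists g : W -> V,
    (forall z, z \in s -> g z \in S (col z)) /\
    (forall z z', z \in s -> z' \in s -> z != z' ->
       g z != g z' /\ (col z != col z' -> adj G (g z) (g z'))).
Proof.
move=> Sc Scard; elim=> [_|a s IHs /= /andP[as_ us]].
  have ex z : exists v, v \in S (col z).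
    by apply/card_gt0P; apply: leq_trans (Scard _).
  by have [g gP] := fin_all_exists ex; exists g.
have [g [gS gd]] := IHs us.
pose bad z := g z |: [set v | (c v != c (g z)) && ~~ adj G (g z) v].
have card_bad : #|\bigcup_(z in [set z in s]) bad z| <= #|W| * t.+1.
  apply: leq_trans (leq_card_bigcup _ _) _.
  apply: (@leq_trans (\sum_(z in [set z in s]) t.+1)).
    apply: leq_sum => z; rewrite inE => zs; rewrite (leq_trans (leq_card_setU _ _)) //.
    by rewrite cards1 add1n ltnS good //; have [] := Sc _ _ (gS z zs).
  by rewrite sum_nat_const leq_mul2r max_card orbT.
have [v vS vbad] : exists2 v, v \in S (col a) & v \notin \bigcup_(z in [set z in s]) bad z.
  have : ~~ (S (col a) \subset \bigcup_(z in [set z in s]) bad z).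
    apply: contraTN (Scard (col a)) => /subset_leq_card le1.
    by rewrite -leqNgt (leq_trans le1).
  by case/subsetPn => v; exists v.
have vz z : z \in s -> v != g z /\ (col a != col z -> adj G (g z) v).
  move=> zs; have : v \notin bad z.
    by apply: contraNN vbad => vb; apply/bigcupP; exists z; rewrite // inE.
  have [cv _] := Sc _ _ vS; have [cz _] := Sc _ _ (gS z zs).
  rewrite !inE negb_or cv cz negb_and negbK => /andP[-> vz]; split=> // ne.
  by move: vz; rewrite (negPf ne) negbK.
exists (fun z => if z == a then v else g z); split=> [z|z z'].
  by rewrite inE; case: eqP => [-> _|_ /gS].
rewrite !inE; case: (z =P a) => [->|_] /=; case: (z' =P a) => [->|_] //=.
- by rewrite eqxx.
- by move=> _ z's _; have [vz' av] := vz _ z's; split=> // /av; rewrite adjC.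
- move=> zs _ _; have [vz' av] := vz _ zs; split=> [|]; first by rewrite eq_sym.
  by rewrite eq_sym => /av.
by move=> *; apply: gd.
Qed.

(** The edge [x y] goes to [u w], whose ends may be arbitrary. Without it F is properly coloured
    with [x] and [y] alike; their colour becomes [i], the rest of that colour must only avoid [u]
    and [w], and all other colours are placed greedily among common neighbours of [u] and [w]. *)
Lemma embed_critical (F : graph W) (x y : W) (colF : W -> 'I_k) (u w : V) (i : 'I_k) :
    (forall p q, adj (del_edge F [set x; y]) p q -> colF p != colF q) ->
    colF x = colF y -> adj F x y -> adj G u w ->
    (forall j, j != i -> #|W| * t.+1 <
       #|[set z | [&& z \notin B, c z == j, adj G u z & adj G w z]]|) ->
    #|W| * t.+1 + 2 < #|[set z | (z \notin B) && (c z == i)]| ->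
  exists f, f \in embs F G.
Proof.
move=> colF_del cxy Fxy uw Sj Si; have xy := adj_neq Fxy.
pose col z := tperm (colF x) i (colF z).
pose S j := if j == i then [set z | (z \notin B) && (c z == i)] :\: [set u; w] else
  [set z | [&& z \notin B, c z == j, adj G u z & adj G w z]].
have SP j v : v \in S j -> [/\ c v = j, v \notin B, v != u, v != w &
    j != i -> adj G u v /\ adj G w v].
  rewrite /S; case: (j =P i) => [->|_].
    by rewrite !inE => /andP[/norP[-> ->] /andP[-> /eqP ->]]; split.
  rewrite inE => /and4P[-> /eqP -> uv wv]; split=> //.
    by apply: contraTneq uv => ->; rewrite adj_irr.
  by apply: contraTneq wv => ->; rewrite adj_irr.
have [||g [gS gd]] := greedy_embedding col (S := S) _ _ (enum_uniq (mem [set: W])).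
- by move=> j v /SP[].
- move=> j; rewrite /S; case: (j =P i) => [_|/eqP/Sj//].
  rewrite cardsD ltn_subRL; apply: leq_ltn_trans Si; rewrite addnC leq_add2l.
  by apply: leq_trans (subset_leq_card (subsetIr _ _)) _; rewrite cards2; case: eqP.
have gSz z : g z \in S (col z) by apply: gS; rewrite mem_enum inE.
have {}gd z z' : z != z' -> g z != g z' /\ (col z != col z' -> adj G (g z) (g z')).
  by apply: gd; rewrite mem_enum inE.
have col_x : col x = i by rewrite /col tpermL.
have col_y : col y = i by rewrite /col -cxy tpermL.
have col_F p q : adj F p q -> [set p; q] != [set x; y] -> col p != col q.
  by move=> pq ne; rewrite (inj_eq perm_inj) colF_del // /adj /= in_setD1 ne.
pose f := [ffun z => if z == x then u else if z == y then w else g z].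
have fx : f x = u by rewrite ffunE eqxx.
have fy : f y = w by rewrite ffunE eq_sym (negPf xy) eqxx.
have fz z : z != x -> z != y -> f z = g z by rewrite ffunE => /negPf -> /negPf ->.
have adjF p q : adj F p q -> p \in [set x; y] -> adj G (f p) (f q).
  move=> pq pxy; have [qxy|] := boolP (q \in [set x; y]).
    move: pxy qxy pq; rewrite !inE => /orP[]/eqP -> /orP[]/eqP ->; rewrite ?adj_irr // fx fy //.
    by rewrite [adj G _ _]adjC.
  move=> qxy; have pqxy : [set p; q] != [set x; y].
    by apply: contraNneq qxy => <-; rewrite !inE eqxx orbT.
  have := col_F _ _ pq pqxy; rewrite !inE negb_or in pxy qxy.
  have [qx qy] := andP qxy; have [_ _ _ _ adj_q] := SP _ _ (gSz q); rewrite (fz q) //.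
  case/orP: pxy => /eqP ->; rewrite ?col_x ?col_y eq_sym ?fx ?fy => /adj_q[] //.
exists f; apply/embsP; split=> [p q|p q pq].
  apply: contra_eq => pq; have [gpq _] := gd _ _ pq; rewrite !ffunE.
  have uS z : g z != u by have [] := SP _ _ (gSz z).
  have wS z : g z != w by have [] := SP _ _ (gSz z).
  have u_w := adj_neq uw.
  case: (p =P x) pq => [->|_]; case: (q =P x) => [->|_]; rewrite ?eqxx //.
  - by case: (q =P y) => _ _; rewrite // eq_sym.
  - by case: (p =P y) => _ _; rewrite // eq_sym.
  case: (p =P y) => [->|_]; case: (q =P y) => [->|_] //; rewrite ?eqxx // => _.
  by rewrite eq_sym.
have [pxy|pxy] := boolP (p \in [set x; y]); first exact: adjF.
have [qxy|qxy] := boolP (q \in [set x; y]).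
  by rewrite adjC; apply: adjF => //; rewrite adjC.
have pqxy : [set p; q] != [set x; y].
  by apply: contraNneq qxy => <-; rewrite !inE eqxx orbT.
have := col_F _ _ pq pqxy; rewrite !inE !negb_or in pxy qxy.
have [qx qy] := andP qxy; have [px py] := andP pxy; rewrite !fz //.
by apply: (gd _ _ (adj_neq pq)).2.
Qed.

End Greedy.

(** * Cleaning up a near-extremal partition *)

Lemma card_pairs (V : finType) (P : rel V) :
  #|[set p : V * V | P p.1 p.2]| = \sum_v #|[set z | P v z]|.
Proof.
rewrite -sum1_card (partition_big fst predT) //=; apply: eq_bigr => v _.
rewrite sum1_card -(card_imset (mem [set z | P v z]) (f := pair v)); last by move=> z z' [].
apply: eq_card => -[v' z]; apply/andP/imsetP => [[]|[z' + [-> ->]]].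
  by rewrite inE /= => Pz /eqP <-; exists z; rewrite ?inE.
by rewrite /= !inE.
Qed.

Lemma leq_sum_sub (V : finType) (A : {set V}) (F : V -> nat) m :
  (forall v, v \in A -> m <= F v) -> #|A| * m <= \sum_v F v.
Proof.
move=> Fm; rewrite -sum_nat_const big_mkcond /=; apply: leq_sum => v _.
by case: ifP => // /Fm.
Qed.

Section Cleanup.

Variables (U V W : finType) (H : graph U) (F : graph W) (G : graph V).
Variables (k : nat) (c : V -> 'I_k).
Local Notation h := #|U|.
Local Notation n := #|V|.

Variables (colH : U -> 'I_k) (p q : U).
Hypotheses (colH_proper : forall p q, adj H p q -> colH p != colH q) (Hpq : adj H p q).
Variables (colF : W -> 'I_k) (x y : W).
Hypotheses (colF_proper : forall p q, adj (del_edge F [set x; y]) p q -> colF p != colF q).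
Hypotheses (colF_xy : colF x = colF y) (Fxy : adj F x y).
Hypothesis freeG : is_free F G.

Definition bad_vertices t : {set V} :=
  [set v | t < #|[set z | adj (multipartite c) v z != adj G v z]|].

Lemma card_bad_vertices t : #|bad_vertices t| * t.+1 <= #|wrong (multipartite c) G|.
Proof.
rewrite /wrong (card_pairs (fun v z => adj (multipartite c) v z != adj G v z)).
by apply: leq_sum_sub => v; rewrite inE.
Qed.

(* Thresholds: [t3] wrong pairs make a vertex bad, at most [t2] neighbours are
   tolerated inside a class, more than [t1] missing cross edges pay for them. *)
Lemma exists_cleanup (t1 t2 t3 a m : nat) (B := bad_vertices t3) :
    #|W| * t3.+1 + 2 + #|B| + t3 <= t2 ->
    (forall i, a <= #|[set v | c v == i]|) ->
    #|W| * t3.+1 + 2 + #|B| + 2 * t1 < a ->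
    m.+2 * h + #|B| <= a ->
    h ^ 2 * (2 * (t2 + #|B|)) * n ^ (h - 2) <= t1 * m ^ (h - 2) ->
  exists c' : V -> 'I_k, #|embs H G| <= #|embs H (multipartite c')|.
Proof.
move=> le_t2 class_a lt_a le_a le_t1.
have cardD3 (A X Y Z : {set V}) : A \subset X :|: Y :|: Z -> #|A| <= #|X| + #|Y| + #|Z|.
  move=> /subset_leq_card le1; apply: leq_trans le1 _.
  by rewrite (leq_trans (leq_card_setU _ _)) // leq_add2r (leq_card_setU _ _).
have cardD2 (A X Y : {set V}) : A \subset X :|: Y -> #|A| <= #|X| + #|Y|.
  by move=> /subset_leq_card le1; rewrite (leq_trans le1) // (leq_card_setU _ _).
have goodB v : v \notin B -> #|[set z | adj (multipartite c) v z != adj G v z]| <= t3.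
  by rewrite inE -leqNgt.
clearbody B.
have good v : v \notin B -> #|[set z | (c z != c v) && ~~ adj G v z]| <= t3.
  move=> /goodB; apply: leq_trans; apply/subset_leq_card/subsetP => z; rewrite !inE.
  by rewrite adj_multipartite eq_sym => /andP[-> /negPf ->].
have good_in v : v \notin B -> #|[set z | (c z == c v) && adj G v z]| <= t3.
  move=> /goodB; apply: leq_trans; apply/subset_leq_card/subsetP => z; rewrite !inE.
  by rewrite adj_multipartite => /andP[/eqP -> ->]; rewrite eqxx.
have no_F u w i : adj G u w ->
    (forall j, j != i -> #|W| * t3.+1 <
       #|[set z | [&& z \notin B, c z == j, adj G u z & adj G w z]]|) ->
    #|W| * t3.+1 + 2 < #|[set z | (z \notin B) && (c z == i)]| -> False.
  move=> uw Sj Si.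
  have [f fF] := embed_critical good colF_proper colF_xy Fxy uw Sj Si.
  by move/is_freeP: freeG => /(_ f); rewrite fF.
(* Otherwise [v] has a neighbour [w] outside [B] in its own class. Since [w] misses at most [t3]
   vertices of the other classes, the many neighbours of [v] there are mostly common, and [v w]
   hosts the critical edge. *)
have sparse_class v : exists i, #|[set z | (c z == i) && adj G v z]| <= t2.
  have [/existsP[i] ?|none] := boolP [exists i, #|[set z | (c z == i) && adj G v z]| <= t2].
    by exists i.
  exfalso; have dense i : t2 < #|[set z | (c z == i) && adj G v z]|.
    by rewrite ltnNge; apply: contraNN none => le_i; apply/existsP; exists i.
  have [w] : exists w, w \in [set z | (c z == c v) && adj G v z] :\: B.
    apply/set0Pn; rewrite -card_gt0 cardsD subn_gt0; apply: leq_ltn_trans (dense (c v)).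
    by apply: leq_trans (subset_leq_card (subsetIr _ _)) _; lia.
  rewrite !inE => /andP[wB /andP[/eqP cw vw]].
  apply: (no_F v w (c v) vw) => [j jv|].
    have := dense j; have : [set z | (c z == j) && adj G v z] \subset
        [set z | [&& z \notin B, c z == j, adj G v z & adj G w z]] :|: B :|:
        [set z | (c z != c w) && ~~ adj G w z].
      apply/subsetP => z; rewrite !inE => /andP[/eqP -> ->].
      by rewrite cw jv eqxx /=; case: (z \in B); case: (adj G w z).
    by move/cardD3; have := good _ wB; lia.
  have := dense (c v); have : [set z | (c z == c v) && adj G v z] \subset
      [set z | (z \notin B) && (c z == c v)] :|: B.
    by apply/subsetP => z; rewrite !inE => /andP[-> _]; case: (z \in B).
  by move/cardD2; lia.
have [ch chP] := fin_all_exists sparse_class.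
(* Only vertices of [B] move, so each class loses at most [#|B|] vertices. *)
pose c' v := if v \in B then ch v else c v.
have c'E v : v \notin B -> c' v = c v by rewrite /c' => /negPf ->.
have inner v : #|[set z | (c' z == c' v) && adj G v z]| <= t2 + #|B|.
  have : [set z | (c' z == c' v) && adj G v z] \subset
      [set z | (c z == c' v) && adj G v z] :|: B.
    apply/subsetP => z; rewrite in_setU [in X in X -> _]inE.
    have [_|zB] := boolP (z \in B); first by rewrite orbT.
    by rewrite (c'E z zB) orbF inE.
  move/cardD2/leq_trans; apply; rewrite leq_add2r /c'.
  case: ifP => [_|/negbT/good_in]; first exact: chP.
  by move=> le3; apply: leq_trans le3 _; lia.
pose M v := [set z | (c' z != c' v) && ~~ adj G v z].
pose A := [set v | t1 < #|M v|].
(* If both ends of an inner edge missed at most [t1] cross edges, every other class would still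
   contain enough common neighbours outside [B] to complete a copy of F. *)
have inner_A u w : adj G u w -> c' u = c' w -> (u \in A) || (w \in A).
  move=> uw cuw; apply/negPn/negP; rewrite negb_or !inE -!leqNgt => /andP[Mu Mw].
  apply: (no_F u w (c' u) uw) => [j ju|].
    have := class_a j; have : [set z | c z == j] \subset
        [set z | [&& z \notin B, c z == j, adj G u z & adj G w z]] :|: B :|: (M u :|: M w).
      apply/subsetP => z; rewrite [in X in X -> _]inE => /eqP cz; rewrite !in_setU.
      have [_|zB] := boolP (z \in B); first by rewrite orbT.
      rewrite orbF !inE zB cz -cuw c'E // cz ju eqxx /=.
      by do 2![case: (adj _ _ _)].
    by move/cardD3; have := leq_card_setU (M u) (M w) : _ <= _; lia.
  have := class_a (c' u); have : [set z | c z == c' u] \subset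
      [set z | (z \notin B) && (c z == c' u)] :|: B.
    by apply/subsetP => z; rewrite !inE => ->; case: (z \in B).
  by move/cardD2; lia.
exists c'; set T' := multipartite c'.
have lostT' : #|A| * t1 <= #|lost T' G|.
  rewrite /lost (card_pairs (fun v z => adj T' v z && ~~ adj G v z)).
  apply: leq_sum_sub => v; rewrite inE => /ltnW le1; apply: leq_trans le1 _.
  apply/subset_leq_card/subsetP => z; rewrite !inE adj_multipartite.
  by rewrite eq_sym.
(* Every inner edge has an end in [A], and [inner] bounds the inner degree there; the factor 2
   accounts for which end it is. *)
have lostG : #|lost G T'| <= #|A| * (2 * (t2 + #|B|)).
  pose L := [set e : V * V | (e.1 \in A) && ((c' e.2 == c' e.1) && adj G e.1 e.2)].
  have card_L : #|L| <= #|A| * (t2 + #|B|).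
    rewrite (card_pairs (fun v z => (v \in A) && ((c' z == c' v) && adj G v z))).
    rewrite -sum_nat_const [leqRHS]big_mkcond /=; apply: leq_sum => v _.
    case: ifP => [vA|vA]; last by rewrite leqn0 cards_eq0; apply/eqP/setP => z; rewrite !inE.
    exact: inner.
  have card_swap : #|[set e | (e.2, e.1) \in L]| = #|L|.
    pose sw (e : V * V) := (e.2, e.1); have swK : involutive sw by case.
    rewrite -(card_imset (mem L) (inv_inj swK)); apply: eq_card => e.
    rewrite inE; apply/idP/imsetP => [eL|[e' e'L ->]]; last by case: e' e'L.
    by exists (sw e); [exact: eL | rewrite swK].
  have sub : lost G T' \subset L :|: [set e | (e.2, e.1) \in L].
    apply/subsetP => -[u w]; rewrite [in X in X -> _]inE /= adj_multipartite negbK.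
    move=> /andP[uw /eqP cuw].
    have /orP[uA|wA] := inner_A u w uw cuw; apply/setUP; [left|right].
      by rewrite inE /= uA cuw eqxx.
    by rewrite inE inE /= wA cuw eqxx adjC.
  apply: leq_trans (subset_leq_card sub) _; apply: leq_trans (leq_card_setU _ _) _.
  by rewrite card_swap mulnCA mul2n -addnn leq_add.
have := embs_exchange (c := c') (m := m) colH_proper G Hpq; rewrite -/T' => exch.
have {exch} : #|embs H G| + #|lost T' G| * m ^ (h - 2) <=
    #|embs H T'| + h ^ 2 * #|lost G T'| * n ^ (h - 2).
  apply: exch => i; have := class_a i; have : [set v | c v == i] \subset [set v | c' v == i] :|: B.
    apply/subsetP => z; rewrite [in X in X -> _]inE in_setU => cz.
    have [_|zB] := boolP (z \in B); first by rewrite orbT.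
    by rewrite orbF inE c'E.
  by move/cardD2; lia.
(* Loss and gain are compared for each vertex of [A], where [le_t1] is exactly the inequality
   needed. *)
have : h ^ 2 * #|lost G T'| * n ^ (h - 2) <= #|lost T' G| * m ^ (h - 2).
  apply: leq_trans (_ : #|A| * (t1 * m ^ (h - 2)) <= _); last first.
    by rewrite mulnA leq_mul2r lostT' orbT.
  apply: leq_trans (_ : #|A| * (h ^ 2 * (2 * (t2 + #|B|)) * n ^ (h - 2)) <= _); last first.
    by rewrite leq_mul2l le_t1 orbT.
  by rewrite [leqRHS]mulnA leq_mul2r [#|A| * _]mulnCA leq_mul2l lostG !orbT.
lia.
Qed.

End Cleanup.

(** * Choice of constants *)

(** A positive integer part is more than half of the exact quotient. *)
Lemma leq_double_divn n d : 0 < d -> d <= n -> n <= 2 * d * (n %/ d).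
Proof.
move=> d0 dn; have q0 : 0 < n %/ d by rewrite divn_gt0.
have := divn_eq n d; have := ltn_pmod n d0; nia.
Qed.

Lemma card_lost_leq_wrong (V : finType) (G T : graph V) :
  #|lost G T| <= #|wrong T G|.
Proof.
apply/subset_leq_card/subsetP => e; rewrite !inE;
  by case: (adj G _ _); case: (adj T _ _).
Qed.

Lemma card_embs_wrong (U V : finType) (H : graph U) (G T : graph V) :
  #|embs H G| <= #|embs H T| + #|U| ^ 2 * #|wrong T G| * #|V| ^ (#|U| - 2).
Proof.
rewrite -(cardsID (embs H T) (embs H G)); apply: leq_add.
  exact: subset_leq_card (subsetIr _ _).
apply: leq_trans (card_embs_lost H G T) _.
by rewrite leq_mul2r leq_mul2l card_lost_leq_wrong !orbT.
Qed.

Section Core.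

Variables (U : finType) (H : graph U) (k : nat).
Local Notation h := #|U|.

Variables (colH : U -> 'I_k) (p q : U).
Hypotheses (colH_proper : forall p q, adj H p q -> colH p != colH q) (Hpq : adj H p q).

(** A balanced partition into [k] classes already carries a positive proportion of all [n ^ h]
    maps. *)
Lemma extremal_lower (C := (2 * (k * h)) ^ h) (V : finType) N :
    k * h <= #|V| ->
    (forall c : V -> 'I_k, #|embs H (multipartite c)| <= N) ->
  #|V| ^ h <= C * N.
Proof.
move=> kn max_N; have k0 : 0 < k by case: (colH p) => i; case: (k).
have h0 : 0 < h by apply/card_gt0P; exists p.
have kh0 : 0 < k * h by rewrite muln_gt0 k0.
set n := #|V| in kn *; pose m := n %/ (k * h).
have [||c cP] := @equisplit V 'I_k setT (m * h).
- by rewrite card_ord.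
- by rewrite card_ord cardsT -mulnA [h * k]mulnC leq_trunc_div.
have : m ^ h <= N.
  apply: leq_trans (max_N c).
  apply: leq_trans (leq_card_embs (c := c) colH_proper _) _ => [u|].
    by apply: leq_trans (cP (colH u)) _; apply/subset_leq_card/subsetP => v; rewrite !inE.
  by apply/subset_leq_card/subsetP => f /setIdP[].
move=> le_m; apply: leq_trans (_ : (2 * (k * h) * m) ^ h <= _).
  by rewrite leq_exp2r // leq_double_divn.
by rewrite expnMn leq_mul2l le_m orbT.
Qed.

(** [G] has order [n ^ h] embeddings, hence so does the nearby multipartite graph, and H has a
    colouring using only large classes. If some class [s] were tiny, [split_class_gain] would
    produce a multipartite graph with more embeddings than [G]. *)
Lemma large_classes :
  exists M Q n0, [/\ 0 < M, 0 < Q & forall (V : finType) (G : graph V) (c : V -> 'I_k),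
    n0 <= #|V| ->
    (forall c' : V -> 'I_k, #|embs H (multipartite c')| <= #|embs H G|) ->
    Q * #|wrong (multipartite c) G| <= #|V| ^ 2 ->
    forall i, #|V| <= M * #|[set v | c v == i]|].
Proof.
have k0 : 0 < k by case: (colH p) => i; case: (k).
have h2 : 1 < h.
  apply: leq_trans (_ : #|[set p; q]| <= h); last exact: max_card.
  by rewrite cards2 (adj_neq Hpq).
pose C0 := (2 * (k * h)) ^ h; pose C1 := 2 * C0 * h * k + 1.
pose C2 := (2 * (h * 2 * C1)) ^ h.
pose M := C1 + 8 * C2 * h ^ 2; pose Q := 2 * C0 * h ^ 2 + 8 * C2 * h ^ 2 + 1.
exists M, Q, (k * h + h * 2 * C1); split=> [||V G c].
- by rewrite /M /C1 addn1 addSn.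
- by rewrite /Q addn1.
set n := #|V|; set w := #|wrong _ _| => n_large max_G Qw s.
rewrite leqNgt; apply/negP => small_s.
have n0 : 0 < n by apply: leq_trans n_large; rewrite /C1; nia.
have n_h : n ^ h = n ^ 2 * n ^ (h - 2) by rewrite -expnD subnKC.
have n_h1 : n ^ h = n * n ^ (h - 1) by rewrite -expnS subn1 prednK // ltnW.
have nh0 : 0 < n ^ h by rewrite expn_gt0 n0.
(* By the first term of [Q], the wrong pairs cost at most half of the [n ^ h / C0] embeddings
   guaranteed in [G]. *)
have T_large : n ^ h <= 2 * C0 * #|embs H (multipartite c)|.
  have le1 : n ^ h <= C0 * #|embs H G|.
    by apply: extremal_lower max_G; apply: leq_trans n_large; rewrite leq_addr.
  have := card_embs_wrong H G (multipartite c); rewrite -/n -/w => le2.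
  have : 2 * C0 * h ^ 2 * w * n ^ (h - 2) <= n ^ h.
    rewrite n_h leq_mul2r; apply/orP; right; apply: leq_trans Qw.
    by rewrite leq_mul2r /Q; apply/orP; right; lia.
  have : C0 * #|embs H G| <= C0 * (#|embs H (multipartite c)| + h ^ 2 * w * n ^ (h - 2)).
    by rewrite leq_mul2l le2 orbT.
  by rewrite mulnDr !mulnA; lia.
(* The summand [2 * C0 * h * k] of [C1] matches the bound of [exists_large_coloring] with [T_large];
   the added 1 makes the inequality strict. *)
have [|col [col_proper col_large]] :=
    @exists_large_coloring U V H k c (n %/ C1).
  have : 2 * C0 * (h * (k * (n %/ C1)) * n ^ (h - 1)) < n ^ h.
    have : (n %/ C1) * (2 * C0 * h * k) < n.
      have := leq_trunc_div n C1; rewrite {2}/C1 mulnDr muln1.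
      by case: (n %/ C1) => [|t]; lia.
    move=> lt1; rewrite n_h1.
    have -> : 2 * C0 * (h * (k * (n %/ C1)) * n ^ (h - 1)) =
              n %/ C1 * (2 * C0 * h * k) * n ^ (h - 1).
      by rewrite !mulnA; congr (_ * _); lia.
    by rewrite ltn_mul2r lt1 expn_gt0 n0.
  by move=> lt1; have := leq_trans lt1 T_large; rewrite ltn_mul2l => /andP[].
have C1_0 : 0 < C1 by rewrite /C1 addn1.
have {}col_large u : n <= C1 * #|[set v | c v == col u]|.
  apply: leq_trans (ltnW (ltn_ceil n C1_0)) _.
  by rewrite mulnC leq_mul2l (col_large u) orbT.
have col_s u : col u != s.
  apply: contraTneq (col_large u) => ->; rewrite -ltnNge.
  by apply: leq_ltn_trans small_s; rewrite leq_mul2r leq_addr orbT.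
pose m := n %/ (h * 2 * C1).
have [|c'] := @split_class_gain U V H k c col p q s m col_proper Hpq col_s.
  move=> u; rewrite -(leq_pmul2l C1_0); apply: leq_trans (col_large u).
  by rewrite mulnC -!mulnA [_ * (_ * C1)]mulnA leq_trunc_div.
have m_h : n ^ h <= C2 * m ^ h.
  rewrite /C2 -expnMn leq_exp2r; last exact: ltnW.
  apply: leq_double_divn; first by rewrite !muln_gt0 C1_0 ltnW.
  by apply: leq_trans n_large; rewrite leq_addl.
have := max_G c'; have := card_embs_wrong H G (multipartite c); rewrite -/n -/w.
set S := #|[set v | c v == s]| in small_s *.
set eG := #|embs H G|; set eT := #|embs H (multipartite c)|; set eT' := #|embs H (multipartite c')|.
set E := n ^ (h - 2) => le1 le2 le3.
have le4 : m ^ h <= (2 * (h ^ 2 * S * n) + h ^ 2 * w) * E.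
  have arith (a b d e X Y : nat) : a <= b + X -> d <= a -> b + e <= d + Y -> e <= Y + X.
    by clear; lia.
  apply: leq_trans (arith _ _ _ _ _ _ le1 le2 le3) _.
  by rewrite mulnDl -[h ^ 2 * S * n]mulnA [2 * (h ^ 2 * _)]mulnCA.
have le5 : 8 * C2 * h ^ 2 * S * n <= n ^ 2.
  rewrite -mulnn leq_mul2r; apply/orP; right; apply: leq_trans (ltnW small_s).
  by rewrite leq_mul2r leq_addl orbT.
have le6 : 8 * C2 * h ^ 2 * w <= n ^ 2.
  by apply: leq_trans Qw; rewrite leq_mul2r /Q -addnA [_ + 1]addnC addnA leq_addl orbT.
(* The tiny class costs two shares of [n ^ h] and the wrong pairs one, against a gain of eight: with
   [m_h] this reads [8 * n ^ h <= 3 * n ^ h]. *)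
have : 8 * (C2 * m ^ h) <= 3 * n ^ h.
  apply: leq_trans (_ : 8 * (C2 * ((2 * (h ^ 2 * S * n) + h ^ 2 * w) * E)) <= _).
    by rewrite !leq_mul2l le4 !orbT.
  rewrite n_h !mulnA leq_mul2r; apply/orP; right.
  by move: le5 le6; clear; lia.
by move: m_h nh0; clear; lia.
Qed.

Variables (W : finType) (F : graph W) (colF : W -> 'I_k) (x y : W).
Hypotheses (colF_proper : forall p q, adj (del_edge F [set x; y]) p q -> colF p != colF q).
Hypotheses (colF_xy : colF x = colF y) (Fxy : adj F x y).

Lemma near_extremal_multipartite :
  exists Q n0, 0 < Q /\ forall (V : finType) (G : graph V) (c : V -> 'I_k),
    n0 <= #|V| -> is_free F G ->
    (forall c' : V -> 'I_k, #|embs H (multipartite c')| <= #|embs H G|) ->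
    Q * #|wrong (multipartite c) G| <= #|V| ^ 2 ->
    exists c' : V -> 'I_k, #|embs H G| <= #|embs H (multipartite c')|.
Proof.
have [M [Q1 [n1 [M0 Q1_0 classes]]]] := large_classes.
have h2 : 1 < h.
  apply: leq_trans (_ : #|[set p; q]| <= h); last exact: max_card.
  by rewrite cards2 (adj_neq Hpq).
set f := #|W|.
(* [M1], [M2], [M3] are the denominators of [t1], [t2], [t3]. [C3] converts powers of [m] into
   powers of [n]; [M2] makes [t2] plus the number of bad vertices cheap against [t1]; [M3] keeps
   [f.+1 * t3] below [n / (4 * M2)], and the second term of [Q] does the same for the number of bad
   vertices. *)
pose C3 := (8 * M * h) ^ (h - 2); pose M1 := 8 * M.
pose M2 := 8 * h ^ 2 * C3 * M1; pose M3 := 4 * f.+1 * M2.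
pose Q := Q1 + M3 * (4 * M2).
have C3_0 : 0 < C3 by rewrite expn_gt0; apply/orP; left; nia.
have M2_M1 : M1 <= M2 by rewrite leq_pmull // !muln_gt0 C3_0 (ltnW h2).
have M1_0 : 0 < M1 by rewrite muln_gt0.
have M2_0 : 0 < M2 by apply: leq_trans M2_M1.
have M3_0 : 0 < M3 by rewrite muln_gt0.
exists Q, (n1 + 4 * M2 * (f + 4) + M3 + 8 * M * h + 8 * M); split; first by rewrite addn_gt0 Q1_0.
move=> V G c; set n := #|V|; set w := #|wrong _ _| => n_large freeG max_G Qw.
have [n_n1 n_M2 n_M3 n_h n_M] : [/\ n1 <= n, 4 * M2 * (f + 4) <= n, M3 <= n,
    8 * M * h <= n & 8 * M <= n].
  have arith a b d e g N : a + b + d + e + g <= N ->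
      [/\ a <= N, b <= N, d <= N, e <= N & g <= N] by clear; split; lia.
  exact: arith n_large.
have class_a : forall i, n %/ M <= #|[set v | c v == i]|.
  move=> i; rewrite -(leq_pmul2l M0) mulnC; apply: leq_trans (leq_trunc_div _ _) _.
  apply: (classes V G c n_n1 max_G).
  by apply: leq_trans Qw; rewrite leq_mul2r leq_addr orbT.
pose t1 := n %/ M1; pose t2 := n %/ M2; pose t3 := n %/ M3; pose m := n %/ (4 * M * h).
have card_B : 4 * M2 * #|bad_vertices G c t3| <= n.
  have := card_bad_vertices G c t3; rewrite -/w => le1.
  have n_t3 := ltn_ceil n M3_0; rewrite -/t3 in n_t3.
  set B := #|_| in le1 *.
  have n0 : 0 < n by apply: leq_trans n_M3.
  have le2 : M3 * (4 * M2) * w <= n ^ 2.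
    by apply: leq_trans Qw; rewrite leq_mul2r leq_addl orbT.
  rewrite -(leq_pmul2l n0) mulnn; apply: leq_trans le2.
  apply: leq_trans (_ : M3 * (4 * M2) * (B * t3.+1) <= _); last by rewrite leq_mul2l le1 orbT.
  apply: leq_trans (_ : t3.+1 * M3 * (4 * M2 * B) <= _).
    by rewrite leq_mul2r (ltnW n_t3) orbT.
  by clear; lia.
have le_t1 := leq_trunc_div n M1; have le_t2 := leq_trunc_div n M2.
have le_t3 := leq_trunc_div n M3; have le_m := leq_trunc_div n (4 * M * h).
have ge_t1 : n <= 2 * M1 * t1 by apply: leq_double_divn.
have ge_m : n <= 8 * M * h * m.
  have -> : 8 * M * h = 2 * (4 * M * h) by rewrite !mulnA.
  apply: leq_double_divn; first by rewrite !muln_gt0 M0 (ltnW h2).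
  by apply: leq_trans n_h; rewrite !leq_mul2r !orbT.
rewrite -/t1 -/t2 -/t3 -/m in le_t1 le_t2 le_t3 le_m.
set B := #|_| in card_B.
have le_B : f * t3.+1 + 2 + B + t3 <= t2.
  rewrite leq_divRL //.
  have : 4 * M2 * (f.+1 * t3) <= n.
    by move: le_t3; rewrite /M3; clear; lia.
  by move: card_B n_M2; clear; lia.
have le_M_M2 : 8 * M * t2 <= n.
  by apply: leq_trans le_t2; rewrite mulnC leq_mul2l M2_M1 orbT.
have le_M_B : 8 * M * (f * t3.+1 + 2 + B) <= n.
  apply: leq_trans le_M_M2; rewrite leq_mul2l; apply/orP; right.
  by apply: leq_trans le_B; rewrite leq_addr.
apply: (exists_cleanup (t1 := t1) (t2 := t2) (t3 := t3) (a := n %/ M) (m := m)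
  colH_proper Hpq colF_proper colF_xy Fxy freeG le_B class_a); rewrite -/B.
- rewrite leq_divRL //; move: le_t1 le_M_B n_M; rewrite /M1; clear; lia.
- have le_B' : 8 * M * B <= n by apply: leq_trans le_M_B; rewrite leq_mul2l leq_addl orbT.
  rewrite leq_divRL //; move: le_m le_B' n_h; clear; clearbody m n B; lia.
have le_C3 : n ^ (h - 2) <= C3 * m ^ (h - 2).
  rewrite /C3 -expnMn; case: (h - 2) => [|e]; first by rewrite !expn0.
  by rewrite leq_exp2r.
apply: leq_trans (_ : h ^ 2 * (2 * (t2 + B)) * (C3 * m ^ (h - 2)) <= _).
  by rewrite leq_mul2l le_C3 orbT.
rewrite mulnA leq_mul2r; apply/orP; right.
have le_M2 : M2 * (t2 + B) <= 2 * n.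
  by move: le_t2 card_B; clear; clearbody M2 t2 B n; lia.
rewrite -(leq_pmul2l M1_0); move: le_M2 ge_t1; rewrite /M2; clear; clearbody M1 C3 t1 t2 B n.
by move: (h ^ 2) => h2; lia.
Qed.

End Core.

(** * Chromatic number and the generalized Turan number *)

Lemma graph_ext (V : finType) (G G' : graph V) : adj G =2 adj G' -> G = G'.
Proof.
move=> eqG; apply: val_inj; apply/setP => e /=; apply/idP/idP => eG;
  have [u [v [euv uv]]] := edgeP eG; move: uv; rewrite euv; first by rewrite eqG.
by rewrite -eqG.
Qed.

Lemma multipartite_exists (V : finType) k (T : graph V) :
  complete_multipartite k T -> exists c : V -> 'I_k, T = multipartite c.
Proof.
case/existsP => c /forallP cT; exists c; apply: graph_ext => u v.
by have /forallP/(_ v)/eqP -> := cT u; rewrite adj_multipartite.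
Qed.

Lemma colorableP (V : finType) k (G : graph V) :
  (exists c : V -> 'I_k, forall u v, adj G u v -> c u != c v) <-> colorable k G.
Proof.
split=> [[c cG]|/existsP[c /forallP cG]].
  apply/existsP; exists [ffun v => c v]; apply/forallP => u; apply/forallP => v.
  by apply/implyP; rewrite !ffunE; apply: cG.
by exists c => u v; have /forallP/(_ v)/implyP := cG u.
Qed.

Lemma chi_leq (V : finType) k (G : graph V) : (chi G <= k) = colorable k G.
Proof.
rewrite /chi; case: ex_minnP => j /colorableP[c cG] min_j.
apply/idP/idP => [jk|]; last exact: min_j.
by apply/colorableP; exists (fun v => widen_ord jk (c v)) => u v /cG.
Qed.

(** An embedding of F would pull [c] back to a proper [k]-colouring of F. *)
Lemma multipartite_free (V W : finType) (F : graph W) k (c : V -> 'I_k) :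
  k < chi F -> is_free F (multipartite c).
Proof.
rewrite ltnNge chi_leq => /negP nF; apply/is_freeP => f; apply/negP => /embsP[_ fF].
by apply: nF; apply/colorableP; exists (fun w => c (f w)) => u v /fF; rewrite adj_multipartite.
Qed.

(** Deleting the edge leaves a graph colourable with one colour fewer; were its ends coloured
    differently, that colouring would be proper for F itself. *)
Lemma critical_coloring (W : finType) (F : graph W) e : color_critical F e ->
  exists x y (colF : W -> 'I_(chi F).-1),
    [/\ forall p q, adj (del_edge F [set x; y]) p q -> colF p != colF q,
        colF x = colF y & adj F x y].
Proof.
case/andP=> /edgeP[x [y [-> Fxy]]] lt_chi.
have le_chi : chi (del_edge F [set x; y]) <= (chi F).-1 by lia.
have /colorableP[c cF] : colorable (chi F).-1 (del_edge F [set x; y]) by rewrite -chi_leq.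
exists x, y, c; split=> //; apply/eqP/negPn/negP => cxy.
suff : chi F <= (chi F).-1 by lia.
rewrite chi_leq; apply/colorableP; exists c => u v uv.
have [euv|euv] := eqVneq [set u; v] [set x; y]; last by apply: cF; rewrite /adj in_setD1 euv.
have u_v := adj_neq uv; have := set21 u v; have := set22 u v; rewrite euv !inE.
by move=> /orP[]/eqP vE /orP[]/eqP uE; move: u_v; rewrite vE uE ?eqxx // => _; rewrite // eq_sym.
Qed.

Lemma gen_turan_attained (n : nat) (U W : finType) (H : graph U) (F : graph W) :
  1 < chi F -> exists2 G : graph 'I_n, is_free F G & gen_turan n H F = ncopies H G.
Proof.
(* A single class gives the edgeless graph, so the maximum ranges over a nonempty family. *)
move=> chiF; pose T := multipartite (fun _ : 'I_n => ord0 : 'I_1).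
have [|G GF maxG] := @eq_bigmax_cond _ (fun G : graph 'I_n => is_free F G) (ncopies H).
  by apply/card_gt0P; exists T; apply: multipartite_free.
by exists G; last exact: maxG.
Qed.

Lemma ncopies_leq_gen_turan (n : nat) (U W : finType) (H : graph U) (F : graph W) (G : graph 'I_n) :
  is_free F G -> ncopies H G <= gen_turan n H F.
Proof. by move=> GF; apply: (leq_bigmax_cond _ GF). Qed.

(** Common form of both assumptions of the theorem, with [eps] replaced by the inverse of a positive
    integer [Q] so that no real numbers remain. *)
Lemma good_of_near_extremal (U W : finType) (H : graph U) (F : graph W) :
    chi H < chi F -> (exists e : {set W}, color_critical F e) ->
    (forall Q, 0 < Q -> exists n0, forall n, n0 <= n -> exists G T : graph 'I_n,
      [/\ is_free F G, ncopies H G = gen_turan n H F,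
          complete_multipartite (chi F).-1 T & Q * edit_dist T G <= n ^ 2]) ->
  weakly_Turan_good H F.
Proof.
move=> chiHF [e critF] near.
have [x [y [colF [colF_proper colF_xy Fxy]]]] := critical_coloring critF.
have k0 : 0 < (chi F).-1 by apply: leq_ltn_trans (ltn_ord (colF x)).
have [/existsP[p /existsP[q pq]]|no_edge] := boolP [exists p, exists q, adj H p q]; last first.
  (* If H has no edge, its embeddings are all the injections, whatever the host graph, so every
     graph has equally many copies. *)
  exists 0 => n _; exists (multipartite (fun _ : 'I_n => Ordinal k0)).
    exact: multipartiteP.
  have [|G _ ->] := gen_turan_attained n H (F := F); first by lia.
  have noH p q : adj H p q = false.
    by apply: contraNF no_edge => pq; apply/existsP; exists p; apply/existsP; exists q.
  have embsE (G' : graph 'I_n) : embs H G' = [set f : {ffun U -> 'I_n} | injectiveb f].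
    apply/setP => f; rewrite [RHS]inE; apply/embsP/injectiveP => [[]|] //.
    by split=> // p q; rewrite noH.
  by apply/eqP; rewrite eqn_leq !leq_ncopies !embsE leqnn.
have /colorableP[colH colH_proper] : colorable (chi F).-1 H by rewrite -chi_leq; lia.
have [Q [n0 [Q0 core]]] :=
  near_extremal_multipartite colH_proper pq colF_proper colF_xy Fxy.
(* The 4 is the factor of [card_wrong]. *)
have [n1 nearQ] := near (Q * 4) ltac:(by rewrite muln_gt0 Q0).
have free_T n (c : 'I_n -> 'I_(chi F).-1) : is_free F (multipartite c).
  by apply: multipartite_free; lia.
exists (maxn n0 n1) => n; rewrite geq_max => /andP[n0n n1n].
have [G [T [GF eqG /multipartite_exists[c ->] dist]]] := nearQ n n1n.
have [||||c' le_c'] := core 'I_n G c; rewrite ?card_ord //.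
- by move=> c'; rewrite -leq_ncopies eqG; apply: ncopies_leq_gen_turan; exact: free_T.
- apply: leq_trans dist; rewrite -mulnA leq_mul2l; apply/orP; right; exact: card_wrong.
exists (multipartite c'); first exact: multipartiteP.
apply/eqP; rewrite eqn_leq -{1}eqG leq_ncopies le_c' /=.
exact/ncopies_leq_gen_turan/free_T.
Qed.

Local Open Scope ring_scope.

Lemma ler_inv_nat (R : realType) (Q d n : nat) : (0 < Q)%N ->
  d%:R <= Q%:R^-1 * n%:R ^+ 2 :> R -> (Q * d <= n ^ 2)%N.
Proof.
move=> Q0; rewrite mulrC ler_pdivlMr ?ltr0n // -natrX -natrM ler_nat.
by rewrite mulnC.
Qed.

Local Close Scope ring_scope.

Theorem theorem1p4 (R : realType) (U W : finType) (H : graph U) (F : graph W)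
    (chiHF : chi H < chi F)
    (critF : exists e : {set W}, color_critical F e) :
  (weakly_Turan_stable R H F -> weakly_Turan_good H F) /\
  (near_multipartite_extremal R H F -> weakly_Turan_good H F).
Proof.
have inv_pos Q : 0 < Q -> (0 < Q%:R^-1 :> R)%R by move=> ?; rewrite invr_gt0 ltr0n.
have chiF : 1 < chi F.
  have [e /critical_coloring[x [_ [colF _]]]] := critF.
  by have := ltn_ord (colF x); lia.
split=> [stable|[G [T [free ext multi dist]]]]; apply: good_of_near_extremal => // Q Q0.
  (* Stability is applied to an extremal graph, which satisfies the counting hypothesis for every
     positive [delta]. *)
  have [delta delta0 [n0 near]] := stable _ (inv_pos Q Q0).
  exists n0 => n le_n; have [G GF eqG] := gen_turan_attained n H chiF.
  have [|T T_multi dist] := near n G le_n GF.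
    by rewrite eqG gerBl mulr_ge0 ?exprn_ge0 ?ler0n // ltW.
  by exists G, T; split=> //; apply: ler_inv_nat dist.
have [n0 near] := dist _ (inv_pos Q Q0); exists n0 => n le_n.
by exists (G n), (T n); split=> //; apply: ler_inv_nat (near n le_n).
Qed.
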